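(* Let $E$ be a graph, $K$ a field with involution, $R$ an involutive $K$-algebra whose involution is positive definite, and $t$ a canonical, $K$-linear, $R$-valued trace on $L_K(E)$. Then $t$ is faithful if and only if both (P) $t\big(v-\sum_{e\in I}\mathbf{r}(e)\big)\ge 0$ for every vertex $v$ and every finite subset $I\subseteq\mathbf{s}^{-1}(v)$, and (F) $t(v)>0$ for every vertex $v$ hold.
   Context: A (directed) graph $E=(E^0,E^1,\mathbf{s},\mathbf{r})$ has vertex set $E^0$, edge set $E^1$, source and range maps; no finiteness or countability is assumed. A path is a vertex $v$ (length $0$, $\mathbf{s}(v)=\mathbf{r}(v)=v$) or a sequence $p=e_1\cdots e_n$ of edges with $\mathbf{r}(e_i)=\mathbf{s}(e_{i+1})$, $\mathbf{s}(p)=\mathbf{s}(e_1)$, $\mathbf{r}(p)=\mathbf{r}(e_n)$. A vertex $v$ is regular if $\mathbf{s}^{-1}(v)$ is nonempty and finite. $K$ is a field with an arbitrary involution $a\mapsto a^*$. $L_K(E)$ is the free $K$-algebra generated by $E^0\cup E^1\cup\{e^*:e\in E^1\}$ subject to (V) $vw=\delta_{v,w}v$; (E1) $\mathbf{s}(e)e=e\mathbf{r}(e)=e$; (E2) $\mathbf{r}(e)e^*=e^*\mathbf{s}(e)=e^*$; (CK1) $e^*f=\delta_{e,f}\mathbf{r}(e)$; (CK2) $v=\sum_{e\in\mathbf{s}^{-1}(v)}ee^*$ for regular $v$; with $p^*=e_n^*\cdots e_1^*$, $v^*=v$, it is involutive via $(\sum a_ip_iq_i^* )^*=\sum a_i^*q_ip_i^*$.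 An involutive $K$-algebra is a $K$-algebra with an involution (additive, $(xy)^*=y^*x^*$, $x^{**}=x$) such that $(ax)^*=a^*x^*$. $x\ge0$ means $x$ is a finite sum of elements $zz^*$; $x>0$ means $x\ge0$ and $x\ne0$; $x\ge y$ means $x-y\ge0$. The involution is positive definite if $\sum_i x_ix_i^*=0$ implies all $x_i=0$. A trace is an additive map with $t(xy)=t(yx)$; $K$-linear means $t(ax)=at(x)$; $t$ is faithful if $x>0$ implies $t(x)>0$. A trace $t$ on $L_K(E)$ is canonical if $t(pq^* )=\delta_{p,q}\,t(\mathbf{r}(p))$ for all paths $p,q$ with $\mathbf{r}(p)=\mathbf{r}(q)$. *)

(* Defs.v *)
(* Leavitt path algebras over arbitrary graphs, built as the
   quotient of the (non-unital) free K-algebra on E^0 ∪ E^1 ∪ (E^1)^* by the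
   congruence generated by the K-algebra axioms and (V),(E1),(E2),(CK1),(CK2). *)
From HB Require Import structures.
From mathcomp Require Import all_boot all_order all_algebra.
From Stdlib Require Import ClassicalEpsilon.
From Stdlib Require List.
Set Implicit Arguments. Unset Strict Implicit. Unset Printing Implicit Defensive.
Import GRing.Theory.
Local Open Scope ring_scope.

Record field_involution (K : fieldType) (kstar : K -> K) : Prop := {
  fi_add : forall a b, kstar (a + b) = kstar a + kstar b;
  fi_mul : forall a b, kstar (a * b) = kstar b * kstar a;
  fi_inv : forall a, kstar (kstar a) = a }.

Record inv_algebra (K : fieldType) (kstar : K -> K) (R : lmodType K)
    (mulR : R -> R -> R) (starR : R -> R) : Prop := {
  ia_assoc : forall x y z, mulR x (mulR y z) = mulR (mulR x y) z;
  ia_mulDl : forall x y z, mulR (x + y) z = mulR x z + mulR y z;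
  ia_mulDr : forall x y z, mulR x (y + z) = mulR x y + mulR x z;
  ia_scalel : forall (a : K) x y, mulR (a *: x) y = a *: mulR x y;
  ia_scaler : forall (a : K) x y, mulR x (a *: y) = a *: mulR x y;
  ia_starD : forall x y, starR (x + y) = starR x + starR y;
  ia_starM : forall x y, starR (mulR x y) = mulR (starR y) (starR x);
  ia_starK : forall x, starR (starR x) = x;
  ia_starZ : forall (a : K) x, starR (a *: x) = kstar a *: starR x }.

Definition Rge0 (K : fieldType) (R : lmodType K) (mulR : R -> R -> R)
    (starR : R -> R) (x : R) : Prop :=
  exists zs : seq R, x = \sum_(z <- zs) mulR z (starR z).
Definition Rgt0 (K : fieldType) (R : lmodType K) (mulR : R -> R -> R)
    (starR : R -> R) (x : R) : Prop :=
  Rge0 mulR starR x /\ x <> 0.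

Definition pos_definite (K : fieldType) (R : lmodType K) (mulR : R -> R -> R)
    (starR : R -> R) : Prop :=
  forall zs : seq R, \sum_(z <- zs) mulR z (starR z) = 0 ->
    forall z, z \in zs -> z = 0.

Section LPA.
Variables (V E : Type) (s r : E -> V) (K : fieldType).

Inductive gen : Type := GV of V | GE of E | GS of E.  (* v, e, e^* *)

Inductive term : Type :=
  | Tgen of gen
  | T0
  | Tadd of term & term
  | Tscale of K & term
  | Tmul of term & term.

Fixpoint tsum (l : seq term) : term :=
  match l with [::] => T0 | x :: l' => Tadd x (tsum l') end.

Definition tv v := Tgen (GV v).
Definition te e := Tgen (GE e).
Definition ts e := Tgen (GS e).

Definition regular_enum (v : V) (l : seq E) : Prop :=
  l <> [::] /\ List.NoDup l /\ (forall e, s e = v <-> List.In e l).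

Inductive lrel : term -> term -> Prop :=
  | lr_refl x : lrel x x
  | lr_sym x y : lrel x y -> lrel y x
  | lr_trans x y z : lrel x y -> lrel y z -> lrel x z
  | lr_add x x' y y' : lrel x x' -> lrel y y' -> lrel (Tadd x y) (Tadd x' y')
  | lr_scale a x x' : lrel x x' -> lrel (Tscale a x) (Tscale a x')
  | lr_mul x x' y y' : lrel x x' -> lrel y y' -> lrel (Tmul x y) (Tmul x' y')
  | lr_addA x y z : lrel (Tadd x (Tadd y z)) (Tadd (Tadd x y) z)
  | lr_addC x y : lrel (Tadd x y) (Tadd y x)
  | lr_add0 x : lrel (Tadd x T0) x
  | lr_addN x : lrel (Tadd x (Tscale (-1) x)) T0
  | lr_scaleDr a x y : lrel (Tscale a (Tadd x y)) (Tadd (Tscale a x) (Tscale a y))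
  | lr_scaleDl a b x : lrel (Tscale (a + b) x) (Tadd (Tscale a x) (Tscale b x))
  | lr_scaleA a b x : lrel (Tscale a (Tscale b x)) (Tscale (a * b) x)
  | lr_scale1 x : lrel (Tscale 1 x) x
  | lr_mulA x y z : lrel (Tmul x (Tmul y z)) (Tmul (Tmul x y) z)
  | lr_mulDl x y z : lrel (Tmul (Tadd x y) z) (Tadd (Tmul x z) (Tmul y z))
  | lr_mulDr x y z : lrel (Tmul x (Tadd y z)) (Tadd (Tmul x y) (Tmul x z))
  | lr_scalel a x y : lrel (Tmul (Tscale a x) y) (Tscale a (Tmul x y))
  | lr_scaler a x y : lrel (Tmul x (Tscale a y)) (Tscale a (Tmul x y))
  | lr_V v : lrel (Tmul (tv v) (tv v)) (tv v)
  | lr_V0 v w : v <> w -> lrel (Tmul (tv v) (tv w)) T0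
  | lr_E1s e : lrel (Tmul (tv (s e)) (te e)) (te e)
  | lr_E1r e : lrel (Tmul (te e) (tv (r e))) (te e)
  | lr_E2r e : lrel (Tmul (tv (r e)) (ts e)) (ts e)
  | lr_E2s e : lrel (Tmul (ts e) (tv (s e))) (ts e)
  | lr_CK1 e : lrel (Tmul (ts e) (te e)) (tv (r e))
  | lr_CK1' e f : e <> f -> lrel (Tmul (ts e) (te f)) T0
  | lr_CK2 v l : regular_enum v l ->
      lrel (tv v) (tsum (map (fun e => Tmul (te e) (ts e)) l)).

Definition LPA : Type := {P : term -> Prop | exists x, P = lrel x}.

Definition Lclass (x : term) : LPA :=
  exist _ (lrel x) (ex_intro _ x erefl).
Definition Lrepr (q : LPA) : term :=
  proj1_sig (constructive_indefinite_description _ (proj2_sig q)).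

Definition Lzero : LPA := Lclass T0.
Definition Ladd (p q : LPA) : LPA := Lclass (Tadd (Lrepr p) (Lrepr q)).
Definition Lscale (a : K) (q : LPA) : LPA := Lclass (Tscale a (Lrepr q)).
Definition Lmul (p q : LPA) : LPA := Lclass (Tmul (Lrepr p) (Lrepr q)).
Definition Lsub (p q : LPA) : LPA := Ladd p (Lscale (-1) q).
Fixpoint Lsum (l : seq LPA) : LPA :=
  match l with [::] => Lzero | x :: l' => Ladd x (Lsum l') end.
Definition Lvert (v : V) : LPA := Lclass (tv v).

Fixpoint tstar (kstar : K -> K) (x : term) : term :=
  match x with
  | Tgen (GV v) => Tgen (GV v)
  | Tgen (GE e) => Tgen (GS e)
  | Tgen (GS e) => Tgen (GE e)
  | T0 => T0
  | Tadd x y => Tadd (tstar kstar x) (tstar kstar y)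
  | Tscale a x => Tscale (kstar a) (tstar kstar x)
  | Tmul x y => Tmul (tstar kstar y) (tstar kstar x)
  end.
Definition Lstar (kstar : K -> K) (q : LPA) : LPA := Lclass (tstar kstar (Lrepr q)).

Definition Lge0 (kstar : K -> K) (x : LPA) : Prop :=
  exists zs : seq LPA, x = Lsum (map (fun z => Lmul z (Lstar kstar z)) zs).
Definition Lgt0 (kstar : K -> K) (x : LPA) : Prop := Lge0 kstar x /\ x <> Lzero.

(* paths: a pair (v, l) with l a walk starting at v; (v, [::]) is the vertex v *)
Fixpoint walk (v : V) (l : seq E) : Prop :=
  match l with [::] => True | e :: l' => s e = v /\ walk (r e) l' end.
Fixpoint pend (v : V) (l : seq E) : V :=
  match l with [::] => v | e :: l' => pend (r e) l' end.

Fixpoint tprod (x : term) (l : seq term) : term :=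
  match l with [::] => x | y :: l' => Tmul x (tprod y l') end.
Definition pterm (v : V) (l : seq E) : term :=
  match l with [::] => tv v | e :: l' => tprod (te e) (map te l') end.
Definition gpterm (v : V) (l : seq E) : term :=
  match rev l with [::] => tv v | e :: l' => tprod (ts e) (map ts l') end.

Definition Lpq (v : V) (l : seq E) (w : V) (m : seq E) : LPA :=
  Lmul (Lclass (pterm v l)) (Lclass (gpterm w m)).

End LPA.

Arguments Lvert {V E s r K}.

Section Traces.
Variables (V E : Type) (s r : E -> V) (K : fieldType) (R : lmodType K).

Definition is_trace (t : LPA s r K -> R) : Prop :=
  (forall x y, t (Ladd x y) = t x + t y) /\
  (forall x y, t (Lmul x y) = t (Lmul y x)).

Definition K_linear (t : LPA s r K -> R) : Prop :=
  forall (a : K) x, t (Lscale a x) = a *: t x.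

Definition canonical_trace (t : LPA s r K -> R) : Prop :=
  forall (v : V) (l : seq E) (w : V) (m : seq E),
    walk s r v l -> walk s r w m -> pend r v l = pend r w m ->
    ((v, l) = (w, m) -> t (Lpq s r K v l w m) = t (Lvert (pend r v l))) /\
    ((v, l) <> (w, m) -> t (Lpq s r K v l w m) = 0).

Definition faithful_trace (kstar : K -> K) (mulR : R -> R -> R) (starR : R -> R)
    (t : LPA s r K -> R) : Prop :=
  forall x : LPA s r K, Lgt0 kstar x -> Rgt0 mulR starR (t x).

End Traces.

(* Main.v *)
(** Call [z] definite if [t (z z^* ) >= 0], with [t (z z^* ) = 0] only for [z = 0]; since the
    involution of [R] is positive definite, [t] is faithful iff every [z] is definite. If
    [z = \sum_y z y y^*] then [z z^* = \sum_y (z y) (z y)^*], so [z] is definite as soon as all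
    [z y] are. Write [z = \sum_i a_i p_i q_i^*] and induct on the maximal length of the [q_i].
    Taking vertices for the [y]'s reduces to the case where all [q_i] start at the same vertex
    [v]. Let [I] be the set of first edges of the [q_i] and [P = v - \sum_(e in I) e e^*], a
    projection; take for [y] the element [P] and the edges [e] in [I]. Multiplying by [e]
    shortens the [q_i], while [z P = (\sum_g c_g g) P] for distinct paths [g], and canonicity
    gives [t ((z P) (z P)^* ) = \sum_g c_g c_g^* t P]. By (P) this is nonnegative, and by (F),
    (P) for [I] with one more edge, and (CK2), [t P = 0] forces [P = 0].

    Conversely, (P) is the positivity of [t] on the projections [P], and (F) amounts to the
    fact that no vertex vanishes in the algebra. *)
Require Import Defs.
From HB Require Import structures.
From mathcomp Require Import all_boot all_order all_algebra.
From mathcomp Require Import boolp.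
From Stdlib Require List.
Import GRing.Theory.
Set Implicit Arguments.
Unset Strict Implicit.
Unset Printing Implicit Defensive.
Local Open Scope ring_scope.

(** * The quotient as an algebra with involution *)

Section Quotient.
Variables (V E : Type) (s r : E -> V) (K : fieldType).
Implicit Types (x y : term V E K) (p q : LPA s r K).
Local Notation cls := (@Lclass V E s r K).

(** A class is the predicate [lrel x] itself, so its equality rests on predicate extensionality and
    on proof irrelevance for the attached existence proof. *)
Lemma LclassE x y : lrel s r x y -> cls x = cls y.
Proof.
move=> xy; apply: eq_exist; apply/predeqP => z; split=> ?.
  exact: lr_trans (lr_sym xy) _.
exact: lr_trans xy _.
Qed.

Lemma Lclass_inj x y : cls x = cls y -> lrel s r x y.
Proof. by move=> [->]; exact: lr_refl. Qed.

Lemma LreprK q : cls (Lrepr q) = q.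
Proof.
rewrite /Lrepr; case: ClassicalEpsilon.constructive_indefinite_description => x /= qx.
by case: q qx => P hP /= qx; apply: eq_exist.
Qed.

Lemma Lrepr_class x : lrel s r (Lrepr (cls x)) x.
Proof. by apply: Lclass_inj; rewrite LreprK. Qed.

Lemma Lclass_ind (P : LPA s r K -> Prop) : (forall x, P (cls x)) -> forall q, P q.
Proof. by move=> clsP q; rewrite -(LreprK q). Qed.

Lemma Ladd_class x y : Ladd (cls x) (cls y) = cls (Tadd x y).
Proof. by apply/LclassE/lr_add; exact: Lrepr_class. Qed.

Lemma Lscale_class a x : Lscale a (cls x) = cls (Tscale a x).
Proof. by apply/LclassE/lr_scale; exact: Lrepr_class. Qed.

Lemma Lmul_class x y : Lmul (cls x) (cls y) = cls (Tmul x y).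
Proof. by apply/LclassE/lr_mul; exact: Lrepr_class. Qed.

Lemma LaddA : associative (@Ladd V E s r K).
Proof.
elim/Lclass_ind=> x; elim/Lclass_ind=> y; elim/Lclass_ind=> z.
by rewrite !Ladd_class; apply/LclassE/lr_addA.
Qed.

Lemma LaddC : commutative (@Ladd V E s r K).
Proof.
elim/Lclass_ind=> x; elim/Lclass_ind=> y.
by rewrite !Ladd_class; apply/LclassE/lr_addC.
Qed.

Lemma Ladd0 : left_id (Lzero s r K) (@Ladd V E s r K).
Proof.
elim/Lclass_ind=> x; rewrite LaddC !Ladd_class; exact/LclassE/lr_add0.
Qed.

Lemma LaddN : left_inverse (Lzero s r K) (@Lscale V E s r K (-1)) (@Ladd V E s r K).
Proof.
elim/Lclass_ind=> x; rewrite LaddC Lscale_class !Ladd_class.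
exact/LclassE/lr_addN.
Qed.

HB.instance Definition _ := gen_eqMixin (LPA s r K).
HB.instance Definition _ := gen_choiceMixin (LPA s r K).
HB.instance Definition _ := GRing.isZmodule.Build (LPA s r K) LaddA LaddC Ladd0 LaddN.

Lemma LscaleA a b q : Lscale a (Lscale b q) = Lscale (a * b) q.
Proof.
elim/Lclass_ind: q => x; rewrite !Lscale_class; exact/LclassE/lr_scaleA.
Qed.

Lemma Lscale1 : left_id 1 (@Lscale V E s r K).
Proof. elim/Lclass_ind=> x; rewrite !Lscale_class; exact/LclassE/lr_scale1. Qed.

Lemma LscaleDr : right_distributive (@Lscale V E s r K) +%R.
Proof.
move=> a; elim/Lclass_ind=> x; elim/Lclass_ind=> y.
by rewrite /GRing.add /= Ladd_class !Lscale_class Ladd_class;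
  exact/LclassE/lr_scaleDr.
Qed.

Lemma LscaleDl q : {morph (@Lscale V E s r K)^~ q : a b / a + b}.
Proof.
elim/Lclass_ind: q => x a b.
by rewrite {2}/GRing.add /= !Lscale_class Ladd_class; exact/LclassE/lr_scaleDl.
Qed.

HB.instance Definition _ :=
  GRing.Zmodule_isLmodule.Build K (LPA s r K) LscaleA Lscale1 LscaleDr LscaleDl.

Lemma LaddE p q : Ladd p q = p + q. Proof. by []. Qed.
Lemma LscaleE a q : Lscale a q = a *: q. Proof. by []. Qed.
Lemma LzeroE : Lzero s r K = 0. Proof. by []. Qed.

Lemma LsubE p q : Lsub p q = p - q.
Proof. by rewrite /Lsub LscaleE scaleN1r. Qed.

Lemma LsumE l : Lsum l = \sum_(q <- l) q :> LPA s r K.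
Proof. by elim: l => [|q l IHl]; rewrite ?big_nil ?big_cons //= IHl. Qed.

Lemma LmulA : associative (@Lmul V E s r K).
Proof.
elim/Lclass_ind=> x; elim/Lclass_ind=> y; elim/Lclass_ind=> z.
by rewrite !Lmul_class; apply/LclassE/lr_mulA.
Qed.

Lemma LmulDl : left_distributive (@Lmul V E s r K) +%R.
Proof.
elim/Lclass_ind=> x; elim/Lclass_ind=> y; elim/Lclass_ind=> z.
by rewrite -!LaddE !(Lmul_class, Ladd_class); apply/LclassE/lr_mulDl.
Qed.

Lemma LmulDr : right_distributive (@Lmul V E s r K) +%R.
Proof.
elim/Lclass_ind=> x; elim/Lclass_ind=> y; elim/Lclass_ind=> z.
by rewrite -!LaddE !(Lmul_class, Ladd_class); apply/LclassE/lr_mulDr.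
Qed.

Lemma LscaleAl a p q : Lmul (a *: p) q = a *: Lmul p q.
Proof.
elim/Lclass_ind: p => x; elim/Lclass_ind: q => y.
by rewrite -!LscaleE !(Lmul_class, Lscale_class); apply/LclassE/lr_scalel.
Qed.

Lemma LscaleAr a p q : Lmul p (a *: q) = a *: Lmul p q.
Proof.
elim/Lclass_ind: p => x; elim/Lclass_ind: q => y.
by rewrite -!LscaleE !(Lmul_class, Lscale_class); apply/LclassE/lr_scaler.
Qed.

Lemma Lmul0r q : Lmul 0 q = 0.
Proof. by rewrite -{1}(scale0r (0 : LPA s r K)) LscaleAl scale0r. Qed.

Lemma Lmulr0 q : Lmul q 0 = 0.
Proof. by rewrite -{1}(scale0r (0 : LPA s r K)) LscaleAr scale0r. Qed.

Lemma LmulBl p q u : Lmul (p - q) u = Lmul p u - Lmul q u.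
Proof. by rewrite LmulDl -scaleN1r LscaleAl scaleN1r. Qed.

Lemma LmulBr p q u : Lmul p (q - u) = Lmul p q - Lmul p u.
Proof. by rewrite LmulDr -scaleN1r LscaleAr scaleN1r. Qed.

Lemma Lmul_suml I (l : seq I) (P : pred I) (F : I -> LPA s r K) q :
  Lmul (\sum_(i <- l | P i) F i) q = \sum_(i <- l | P i) Lmul (F i) q.
Proof.
exact: (big_morph (fun p => Lmul p q) (fun p p' => LmulDl p p' q) (Lmul0r q)).
Qed.

Lemma Lmul_sumr I (l : seq I) (P : pred I) (F : I -> LPA s r K) q :
  Lmul q (\sum_(i <- l | P i) F i) = \sum_(i <- l | P i) Lmul q (F i).
Proof. exact: (big_morph (Lmul q) (LmulDr q) (Lmulr0 q)). Qed.

Definition Ledge e : LPA s r K := cls (te V K e).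
Definition Lghost e : LPA s r K := cls (ts V K e).
Local Notation "[ v ]" := (@Lvert V E s r K v).

Lemma Lvert_idem v : Lmul [v] [v] = [v].
Proof. by rewrite Lmul_class; apply/LclassE/lr_V. Qed.

Lemma Lvert_ortho v w : v <> w -> Lmul [v] [w] = 0.
Proof. by move=> vw; rewrite Lmul_class; apply/LclassE/lr_V0. Qed.

Lemma Ledge_src e : Lmul [s e] (Ledge e) = Ledge e.
Proof. by rewrite Lmul_class; apply/LclassE/lr_E1s. Qed.

Lemma Ledge_rng e : Lmul (Ledge e) [r e] = Ledge e.
Proof. by rewrite Lmul_class; apply/LclassE/lr_E1r. Qed.

Lemma Lghost_rng e : Lmul [r e] (Lghost e) = Lghost e.
Proof. by rewrite Lmul_class; apply/LclassE/lr_E2r. Qed.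

Lemma Lghost_src e : Lmul (Lghost e) [s e] = Lghost e.
Proof. by rewrite Lmul_class; apply/LclassE/lr_E2s. Qed.

Lemma Lghost_edge e : Lmul (Lghost e) (Ledge e) = [r e].
Proof. by rewrite Lmul_class; apply/LclassE/lr_CK1. Qed.

Lemma Lghost_edge0 e f : e <> f -> Lmul (Lghost e) (Ledge f) = 0.
Proof. by move=> ef; rewrite Lmul_class; apply/LclassE/lr_CK1'. Qed.

Lemma Lclass_tsum I (l : seq I) (F : I -> term V E K) :
  cls (tsum (map F l)) = \sum_(i <- l) cls (F i).
Proof.
by elim: l => [|i l IHl]; rewrite ?big_nil //= big_cons -Ladd_class IHl.
Qed.

Lemma Lvert_regular v l : regular_enum s v l ->
  [v] = \sum_(e <- l) Lmul (Ledge e) (Lghost e).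
Proof.
move=> vl; rewrite [LHS](LclassE (lr_CK2 _ _ vl)) Lclass_tsum.
by apply: eq_bigr => e _; rewrite Lmul_class.
Qed.

(** * The involution on the quotient *)

Section Involution.
Variables (kstar : K -> K) (HK : field_involution kstar).
Local Notation st := (Lstar kstar).

Lemma kstar1 : kstar 1 = 1.
Proof.
by have := fi_mul HK (kstar 1) 1; rewrite mulr1 (fi_inv HK) mulr1 => <-.
Qed.

Lemma kstar0 : kstar 0 = 0.
Proof. by apply: (addrI (kstar 0)); rewrite -(fi_add HK) !addr0. Qed.

Lemma kstarN1 : kstar (-1) = -1.
Proof.
by apply: (addrI (kstar 1)); rewrite -(fi_add HK) subrr kstar0 kstar1 subrr.
Qed.

(** The involution permutes the defining relations: (E1) and (E2) are exchanged, (V), (CK1) and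
    (CK2) are preserved, and associativity is read backwards. *)
Lemma tstar_lrel x y :
  lrel s r x y -> lrel s r (tstar kstar x) (tstar kstar y).
Proof.
elim=> {x y}; rewrite /= ?kstarN1 ?kstar1; try by constructor.
- by move=> x y z _ ? _; exact: lr_trans.
- by move=> a b x; rewrite (fi_add HK); constructor.
- by move=> a b x; rewrite (fi_mul HK) mulrC; constructor.
- by move=> x y z; apply: lr_sym; constructor.
- by move=> v w vw; constructor; exact: nesym.
- by move=> e f ef; constructor; exact: nesym.
move=> v l vl.
have starE l' : tstar kstar (tsum [seq Tmul (te V K e) (ts V K e) | e <- l']) =
    tsum [seq Tmul (te V K e) (ts V K e) | e <- l'] by elim: l' => //= e l' ->.
by rewrite starE; constructor.
Qed.

Lemma Lstar_class x : st (cls x) = cls (tstar kstar x).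
Proof. by apply/LclassE/tstar_lrel; exact: Lrepr_class. Qed.

Lemma LstarD p q : st (p + q) = st p + st q.
Proof.
elim/Lclass_ind: p => x; elim/Lclass_ind: q => y.
by rewrite -!LaddE Ladd_class !Lstar_class Ladd_class.
Qed.

Lemma LstarZ a q : st (a *: q) = kstar a *: st q.
Proof.
by elim/Lclass_ind: q => x; rewrite -!LscaleE Lscale_class !Lstar_class Lscale_class.
Qed.

Lemma LstarM p q : st (Lmul p q) = Lmul (st q) (st p).
Proof.
elim/Lclass_ind: p => x; elim/Lclass_ind: q => y.
by rewrite Lmul_class !Lstar_class Lmul_class.
Qed.

Lemma Lstar0 : st 0 = 0.
Proof. by rewrite -LzeroE Lstar_class. Qed.

Lemma LstarB p q : st (p - q) = st p - st q.
Proof. by rewrite LstarD -scaleN1r LstarZ kstarN1 scaleN1r. Qed.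

Lemma Lstar_sum I (l : seq I) (P : pred I) (F : I -> LPA s r K) :
  st (\sum_(i <- l | P i) F i) = \sum_(i <- l | P i) st (F i).
Proof. exact: (big_morph st LstarD Lstar0). Qed.

Lemma Lstar_vert v : st [v] = [v]. Proof. exact: Lstar_class. Qed.
Lemma Lstar_edge e : st (Ledge e) = Lghost e. Proof. exact: Lstar_class. Qed.
Lemma Lstar_ghost e : st (Lghost e) = Ledge e. Proof. exact: Lstar_class. Qed.

End Involution.
End Quotient.

(** * Vertices are nonzero *)

Lemma InP (T : eqType) (x : T) (l : seq T) : reflect (List.In x l) (x \in l).
Proof.
elim: l => [|y l IHl] /=; first by constructor.
rewrite in_cons; apply: (iffP orP) => -[].
- by move/eqP->; left.
- by move/IHl; right.
- by move->; left.
by move/IHl; right.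
Qed.

Lemma NoDup_uniq (T : eqType) (l : seq T) : reflect (List.NoDup l) (uniq l).
Proof.
apply: (iffP idP); elim: l => [|x l IHl] /=.
- by constructor.
- by case/andP=> xl /IHl; constructor=> //; apply/InP.
- by [].
by move=> H; inversion H; subst; rewrite IHl // andbT; apply/negP => /InP.
Qed.

Section Representation.
Variables (V E : eqType) (s r : E -> V) (K : fieldType).

(** One enumeration is fixed per regular vertex, so that edges can be encoded by their index; [None]
    stands for sinks and infinite emitters. *)
Definition emitted (v : V) : option (seq E) :=
  if pselect (exists l, regular_enum s v l) is left vl then Some (projT1 (cid vl))
  else None.

Lemma emittedP v l : emitted v = Some l -> regular_enum s v l.
Proof.
by rewrite /emitted; case: pselect => // vl [<-]; case: cid.
Qed.

Lemma emitted_regular v l : regular_enum s v l -> exists l', emitted v = Some l'.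
Proof.
move=> vl; rewrite /emitted; case: pselect => [|[]]; last by exists l.
by move=> ?; eexists.
Qed.

(* For fixed [v], the images of the [push e] with [s e = v] are disjoint, and cover [state] if
   [v] is regular. In that case the edges are told apart by the residue of the second component, otherwise by the head of
   the first. So [LPA] acts on functions on [V * state], as on functions on boundary paths. *)
Local Notation state := (seq E * nat)%type.

Definition push (e : E) (y : state) : state :=
  if emitted (s e) is Some l then (y.1, (y.2 * size l + index e l)%N)
  else (e :: y.1, y.2).

Definition pop (e : E) (y : state) : option state :=
  if emitted (s e) is Some l then
    if (y.2 %% size l == index e l)%N then Some (y.1, y.2 %/ size l)%N else None
  else if y.1 is f :: l then if f == e then Some (l, y.2) else None else None.

Lemma mem_emitted e l : emitted (s e) = Some l -> e \in l.
Proof. by move=> /emittedP[_ [_ /(_ e)[el _]]]; apply/InP/el. Qed.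

Lemma pushK e : pcancel (push e) (pop e).
Proof.
rewrite /push /pop; case def_l: emitted => [l|] [m k] /=; last by rewrite eqxx.
have el : (index e l < size l)%N by rewrite index_mem (mem_emitted def_l).
by rewrite modnMDl modn_small // eqxx divnMDl ?divn_small ?addn0 // (leq_trans _ el).
Qed.

Lemma popK e y z : pop e y = Some z -> push e z = y.
Proof.
rewrite /push /pop; case def_l: emitted => [l|]; case: y => m k /=.
  by case: eqP => // ekl [<-] /=; rewrite -ekl -divn_eq.
by case: m => // f m; case: eqP => // -> [<-].
Qed.

Lemma pop_push0 e f y : e <> f -> s e = s f -> pop e (push f y) = None.
Proof.
move=> ef sef; rewrite /push /pop sef.
case def_l: emitted => [l|]; case: y => m k /=; last by case: eqP => // fe; case: ef.
have fl : (index f l < size l)%N by rewrite index_mem (mem_emitted def_l).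
rewrite modnMDl modn_small //; case: eqP => // ief; case: ef.
have el := mem_emitted def_l; rewrite -sef in def_l.
by rewrite -(nth_index e el) ief nth_index // (mem_emitted def_l).
Qed.

(** This is (CK2) on states: the residue of [y.2] modulo the number of edges leaving [v] singles out
    the one edge whose [push] reaches [y]. *)
Lemma pop_regular v l y : regular_enum s v l ->
  exists2 e, e \in l & forall f, f \in l -> isSome (pop f y) = (f == e).
Proof.
move=> vl; have [l' def_l'] := emitted_regular vl.
have [l'0 [_ l'P]] := emittedP def_l'; have [l0 [_ lP]] := vl.
have l'_gt0 : (0 < size l')%N by case: (l') l'0.
have [e1 e1l] : exists e, e \in l by case: (l) l0 => // e ? _; exists e; exact: mem_head.
have kl' : (y.2 %% size l' < size l')%N by rewrite ltn_mod.
exists (nth e1 l' (y.2 %% size l')); first by apply/InP/lP/l'P/InP; exact: mem_nth.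
move=> f /InP/lP sf; rewrite /pop sf def_l'.
have fl' : f \in l' by apply/InP/l'P.
case: eqP => [->|kf]; first by rewrite nth_index // eqxx.
apply/esym/negbTE/eqP => fE; apply: kf; rewrite fE index_uniq //.
by apply/NoDup_uniq; have [_ []] := emittedP def_l'.
Qed.

Local Notation vect := (V * state -> K).

(** On indicator functions of points, [e] moves the point along [push e] from [r e] to [s e], and
    [e^*] moves it back along [pop e] or kills it. *)
Definition gen_action (g : gen V E) (f : vect) (x : V * state) : K :=
  match g with
  | GV v => if x.1 == v then f x else 0
  | GE e => if x.1 == s e then
              if pop e x.2 is Some y then f (r e, y) else 0
            else 0
  | GS e => if x.1 == r e then f (s e, push e x.2) else 0
  end.

Fixpoint action (u : term V E K) (f : vect) (x : V * state) : K :=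
  match u with
  | Tgen g => gen_action g f x
  | T0 => 0
  | Tadd u v => action u f x + action v f x
  | Tscale a u => a * action u f x
  | Tmul u v => action u (action v f) x
  end.

Lemma actionD u f g x :
  action u (fun y => f y + g y) x = action u f x + action u g x.
Proof.
elim: u f g x => [[v|e|e]||u IHu v IHv|a u IHu|u IHu v IHv] f g x //=.
- by case: ifP; rewrite ?addr0.
- by case: ifP; rewrite ?addr0 //; case: pop; rewrite ?addr0.
- by case: ifP; rewrite ?addr0.
- by rewrite addr0.
- by rewrite IHu IHv addrACA.
- by rewrite IHu mulrDr.
by rewrite -IHu; congr action; apply: funext => y; exact: IHv.
Qed.

Lemma actionZ u a f x : action u (fun y => a * f y) x = a * action u f x.
Proof.
elim: u f x => [[v|e|e]||u IHu v IHv|b u IHu|u IHu v IHv] f x //=.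
- by case: ifP; rewrite ?mulr0.
- by case: ifP; rewrite ?mulr0 //; case: pop; rewrite ?mulr0.
- by case: ifP; rewrite ?mulr0.
- by rewrite mulr0.
- by rewrite IHu IHv mulrDr.
- by rewrite IHu mulrCA.
by rewrite -IHu; congr action; apply: funext => y; exact: IHv.
Qed.

Lemma action_tsum I (l : seq I) (F : I -> term V E K) f x :
  action (tsum (map F l)) f x = \sum_(i <- l) action (F i) f x.
Proof. by elim: l => [|i l IHl]; rewrite ?big_nil ?big_cons //= IHl. Qed.

Lemma action_lrel u v f : lrel s r u v -> action u f = action v f.
Proof.
move=> uv; elim: uv f => {u v} //=.
- by move=> x y z _ + _ + f => -> ->.
- by move=> x x' y y' _ IHx _ IHy f; apply: funext => z; rewrite /= IHx IHy.
- by move=> a x x' _ IHx f; apply: funext => z; rewrite /= IHx.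
- by move=> x x' y y' _ IHx _ IHy f; apply: funext => z; rewrite /= IHx IHy.
- by move=> x y z f; apply: funext => w /=; rewrite addrA.
- by move=> x y f; apply: funext => w /=; rewrite addrC.
- by move=> x f; apply: funext => w /=; rewrite addr0.
- by move=> x f; apply: funext => w /=; rewrite mulN1r subrr.
- by move=> a x y f; apply: funext => w /=; rewrite mulrDr.
- by move=> a b x f; apply: funext => w /=; rewrite mulrDl.
- by move=> a b x f; apply: funext => w /=; rewrite mulrA.
- by move=> x f; apply: funext => w /=; rewrite mul1r.
- by move=> x y z f; apply: funext => w /=; rewrite -actionD.
- by move=> a x y f; apply: funext => w /=; rewrite -actionZ.
- by move=> v f; apply: funext => w /=; case: (w.1 == v).
- move=> v w vw f; apply: funext => x /=.
  by case: eqP => // ->; case: eqP.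
- by move=> e f; apply: funext => x /=; case: (x.1 == s e).
- by move=> e f; apply: funext => x /=; case: pop => [y|] //; rewrite ?eqxx.
- by move=> e f; apply: funext => x /=; case: (x.1 == r e).
- by move=> e f; apply: funext => x /=; rewrite eqxx.
- move=> e f; apply: funext => -[w y] /=; rewrite eqxx pushK.
  by case: eqP => // ->.
- move=> e g eg f; apply: funext => x /=; case: ifP => // _.
  by case: eqP => // seg; rewrite pop_push0 //; exact: nesym.
move=> v l vl f; apply: funext => -[w y]; rewrite action_tsum /=.
have [_ [/NoDup_uniq l_uniq lP]] := vl; have [e el eP] := pop_regular y vl.
rewrite (bigD1_seq e) //= big1_seq ?addr0 => [|g /andP[ge gl]].
  rewrite ((lP e).2 (elimT (InP _ _) el)) eqxx; case: eqP => // ->.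
  by have := eP _ el; rewrite eqxx; case def_z: pop => [z|] //= _; rewrite (popK def_z).
by have := eP _ gl; rewrite (negbTE ge); case: pop => // _; case: ifP.
Qed.

(** The vertex [v] sends the constant function 1 to a function with value 1 at points over [v],
    whereas zero annihilates it. *)
Lemma Lvert_neq0 v : Lvert v <> 0 :> LPA s r K.
Proof.
move=> /Lclass_inj/(action_lrel (fun=> 1))/(congr1 (@^~ (v, ([::], 0%N)))) /=.
by rewrite eqxx => /eqP; rewrite oner_eq0.
Qed.

End Representation.

(** * Positivity of the trace *)

Section Positivity.
Variables (K : fieldType) (kstar : K -> K) (R : lmodType K).
Variables (mulR : R -> R -> R) (starR : R -> R).
Hypotheses (HR : inv_algebra kstar mulR starR) (Hpd : pos_definite mulR starR).
Local Notation ge0 := (Rge0 mulR starR).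

Lemma Rge0_0 : ge0 0.
Proof. by exists [::]; rewrite big_nil. Qed.

Lemma Rge0_add x y : ge0 x -> ge0 y -> ge0 (x + y).
Proof. by move=> [zs ->] [ws ->]; exists (zs ++ ws); rewrite big_cat. Qed.

Lemma Rge0_scale a x : ge0 x -> ge0 ((a * kstar a) *: x).
Proof.
move=> [zs ->]; exists [seq a *: z | z <- zs].
rewrite big_map scaler_sumr; apply: eq_bigr => z _.
by rewrite (ia_starZ HR) (ia_scalel HR) (ia_scaler HR) scalerA.
Qed.

(** Concatenating the two lists gives one vanishing sum of elements [z z^*], to which positive
    definiteness applies. *)
Lemma Rge0_add_eq0 x y : ge0 x -> ge0 y -> x + y = 0 -> x = 0.
Proof.
move=> [zs ->] [ws ->]; rewrite -big_cat => /Hpd zws0.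
rewrite big1_seq // => z /= zin; rewrite (zws0 z) ?mem_cat ?zin //.
by rewrite -{1}(scale0r (0 : R)) (ia_scalel HR) scale0r.
Qed.

Lemma Rge0_sum (I : eqType) (l : seq I) (F : I -> R) :
  (forall i, i \in l -> ge0 (F i)) -> ge0 (\sum_(i <- l) F i).
Proof.
move=> Fge0; rewrite big_seq; elim/big_ind: _ => //.
  exact: Rge0_0.
exact: Rge0_add.
Qed.

Lemma Rge0_sum_eq0 (I : eqType) (l : seq I) (F : I -> R) :
  (forall i, i \in l -> ge0 (F i)) -> \sum_(i <- l) F i = 0 ->
  forall i, i \in l -> F i = 0.
Proof.
move=> Fge0 + i il; rewrite (big_rem i) //=; apply: Rge0_add_eq0; first exact: Fge0.
by apply: Rge0_sum => j /mem_rem; exact: Fge0.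
Qed.

End Positivity.

(** Merging repeated paths leaves one coefficient per distinct path, as is needed before
    orthogonality of distinct paths can be used. *)
Lemma collect_coeffs (K : fieldType) (M : lmodType K) (T : eqType)
    (l : seq (K * T)) (F : T -> M) :
  \sum_(i <- l) i.1 *: F i.2 =
  \sum_(g <- undup [seq i.2 | i <- l]) (\sum_(i <- l | i.2 == g) i.1) *: F g.
Proof.
under [RHS]eq_bigr do rewrite scaler_suml big_mkcond.
rewrite exchange_big /=; apply: eq_big_seq => i il.
rewrite (bigD1_seq i.2) ?undup_uniq ?mem_undup ?map_f //= eqxx big1 ?addr0 // => g.
by rewrite eq_sym => /negbTE ->.
Qed.

(** * Paths and the monomials [p q^*] *)

Section Paths.
Variables (V E : eqType) (s r : E -> V) (K : fieldType).
Local Notation "[ v ]" := (@Lvert V E s r K v).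
Local Notation edge := (@Ledge V E s r K).
Local Notation ghost := (@Lghost V E s r K).
Local Notation walk := (walk s r).
Local Notation pend := (pend r).

(** Unlike in [pterm], the product always ends in the range vertex, which makes the recursion
    uniform; (E1) absorbs that factor. *)
Fixpoint Lpath v (l : seq E) : LPA s r K :=
  if l is e :: l' then Lmul (edge e) (Lpath (r e) l') else [v].

Fixpoint Lgpath v (l : seq E) : LPA s r K :=
  if l is e :: l' then Lmul (Lgpath (r e) l') (ghost e) else [v].

Lemma Lclass_pterm v l : Lclass s r (pterm K v l) = Lpath v l.
Proof.
case: l => // e l; elim: l e => [|f l IHl] e /=; first by rewrite Ledge_rng.
by rewrite -Lmul_class [Lclass _ _ (tprod _ _)]IHl.
Qed.

Lemma Lclass_gpterm v l : Lclass s r (gpterm K v l) = Lgpath v l.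
Proof.
(* Since [gpterm] reverses the list, the first edge of the path is the last factor, which has to be
   split off on the right. *)
have tprodE (x : term V E K) u w : Lclass s r (tprod x (rcons u w)) =
    Lmul (Lclass s r (tprod x u)) (Lclass s r w).
  elim: u x => [|y u IHu] x /=; first by rewrite Lmul_class.
  by rewrite -Lmul_class IHu LmulA -Lmul_class.
case: l => // e l; elim: l e v => [|f l IHl] e v; first by rewrite /= Lghost_rng.
rewrite [RHS]/= -[Lmul _ (ghost f)]/(Lgpath (r e) (f :: l)) -(IHl f (r e)).
rewrite /gpterm rev_cons; case def_u: (rev (f :: l)) => [|g u].
  by move/(congr1 size): def_u; rewrite size_rev.
by rewrite /= map_rcons tprodE.
Qed.

Lemma LpqE v l w m : Lpq s r K v l w m = Lmul (Lpath v l) (Lgpath w m).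
Proof. by rewrite /Lpq Lclass_pterm Lclass_gpterm. Qed.

Lemma pend_rcons v l e : pend v (rcons l e) = r e.
Proof. by elim: l v => //=. Qed.

Lemma walk_rcons v l e : walk v l -> s e = pend v l -> walk v (rcons l e).
Proof. by elim: l v => [|f l IHl] v //= [-> wl] ?; split=> //; exact: IHl. Qed.

Lemma Lpath_end v l : Lmul (Lpath v l) [pend v l] = Lpath v l.
Proof. by elim: l v => [|e l IHl] v /=; rewrite ?Lvert_idem // -LmulA IHl. Qed.

Lemma Lpath_edge v l e :
  s e = pend v l -> Lmul (Lpath v l) (edge e) = Lpath v (rcons l e).
Proof.
elim: l v => [|f l IHl] v /=; last by move=> ?; rewrite -LmulA IHl.
by move=> <-; rewrite Ledge_src Ledge_rng.
Qed.

Lemma Lpath_edge0 v l e : s e <> pend v l -> Lmul (Lpath v l) (edge e) = 0.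
Proof.
move=> se; rewrite -Lpath_end -Ledge_src LmulA -[X in Lmul X _]LmulA.
by rewrite Lvert_ortho ?Lmulr0 ?Lmul0r //; exact: nesym.
Qed.

Lemma Lgpath_src v l : walk v l -> Lmul (Lgpath v l) [v] = Lgpath v l.
Proof.
case: l => [|e l] /=; first by rewrite Lvert_idem.
by move=> [<- _]; rewrite -LmulA Lghost_src.
Qed.

Lemma Lgpath_vert v l w :
  walk v l -> Lmul (Lgpath v l) [w] = if v == w then Lgpath v l else 0.
Proof.
move=> wl; case: eqP => [<-|vw]; first exact: Lgpath_src.
by rewrite -Lgpath_src // -LmulA Lvert_ortho // Lmulr0.
Qed.

Lemma Lgpath_ghost v l e :
  v = r e -> Lmul (Lgpath v l) (ghost e) = Lgpath (s e) (e :: l).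
Proof. by move=> ->. Qed.

Lemma Lgpath_ghost0 v l e :
  walk v l -> v <> r e -> Lmul (Lgpath v l) (ghost e) = 0.
Proof.
move=> wl ve; rewrite -Lgpath_src // -Lghost_rng LmulA -[X in Lmul X _]LmulA.
by rewrite Lvert_ortho // Lmulr0 Lmul0r.
Qed.

Lemma ghost_Lgpath v l e :
  s e = pend v l -> Lmul (ghost e) (Lgpath v l) = Lgpath v (rcons l e).
Proof.
elim: l v => [|f l IHl] v /=; last by move=> ?; rewrite LmulA IHl.
by move=> <-; rewrite Lghost_src Lghost_rng.
Qed.

Lemma Lstar_path (kstar : K -> K) (HK : field_involution kstar) v l :
  Lstar kstar (Lpath v l) = Lgpath v l.
Proof.
elim: l v => [|e l IHl] v /=; first exact: (Lstar_vert s r HK).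
by rewrite (LstarM HK) IHl (Lstar_edge s r HK).
Qed.

(* The triple [(a, (v, l), (w, m))] stands for [a p q^*] with [p = (v, l)] and [q = (w, m)]. *)
Local Notation mono := (K * (V * seq E) * (V * seq E))%type.

Definition mval (i : mono) : LPA s r K :=
  i.1.1 *: Lmul (Lpath i.1.2.1 i.1.2.2) (Lgpath i.2.1 i.2.2).

Definition mwf (i : mono) : Prop :=
  [/\ walk i.1.2.1 i.1.2.2, walk i.2.1 i.2.2 &
      pend i.1.2.1 i.1.2.2 = pend i.2.1 i.2.2].

(** The filtration on which the main induction runs: [n] bounds the length of [q] only, and [p] is
    unrestricted. *)
Definition gspan n (z : LPA s r K) : Prop :=
  exists2 ms : seq mono,
    forall i, i \in ms -> mwf i /\ (size i.2.2 <= n)%N & z = \sum_(i <- ms) mval i.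

Lemma gspan0 n : gspan n 0.
Proof. by exists [::]; rewrite ?big_nil. Qed.

Lemma gspanD n x y : gspan n x -> gspan n y -> gspan n (x + y).
Proof.
move=> [ms msP ->] [ms' ms'P ->]; exists (ms ++ ms'); last by rewrite big_cat.
by move=> i; rewrite mem_cat => /orP[/msP|/ms'P].
Qed.

Lemma gspanZ n a x : gspan n x -> gspan n (a *: x).
Proof.
move=> [ms msP ->]; exists [seq (a * i.1.1, i.1.2, i.2) | i <- ms].
  by move=> _ /mapP[i /msP ? ->].
by rewrite big_map scaler_sumr; apply: eq_bigr => i _; rewrite /mval /= scalerA.
Qed.

Lemma gspanW n n' x : (n <= n')%N -> gspan n x -> gspan n' x.
Proof.
move=> nn' [ms msP ->]; exists ms => // i /msP[wfi ni].
by split=> //; exact: leq_trans nn'.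
Qed.

Lemma gspan_mono n v l w m : walk v l -> walk w m -> pend v l = pend w m ->
  (size m <= n)%N -> gspan n (Lmul (Lpath v l) (Lgpath w m)).
Proof.
move=> wl wm lm mn; exists [:: (1, (v, l), (w, m))].
  by move=> i; rewrite inE => /eqP ->.
by rewrite big_seq1 /mval /= scale1r.
Qed.

Lemma gspan_ind n (P : LPA s r K -> Prop) :
    P 0 -> (forall x y, P x -> P y -> P (x + y)) -> (forall a x, P x -> P (a *: x)) ->
    (forall v l w m, walk v l -> walk w m -> pend v l = pend w m ->
       (size m <= n)%N -> P (Lmul (Lpath v l) (Lgpath w m))) ->
  forall z, gspan n z -> P z.
Proof.
move=> P0 PD PZ Pm z [ms msP ->]; rewrite big_seq; elim/big_ind: _ => // i.
by move=> /msP[[wl wm lm] mn]; apply: PZ; exact: Pm.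
Qed.

Lemma gspan_mulr n n' y :
    (forall v l w m, walk v l -> walk w m -> pend v l = pend w m ->
       (size m <= n)%N -> gspan n' (Lmul (Lmul (Lpath v l) (Lgpath w m)) y)) ->
  forall z, gspan n z -> gspan n' (Lmul z y).
Proof.
move=> ym z; apply: (gspan_ind (P := fun z => gspan n' (Lmul z y))) => // [|x x' ? ?|a x ?].
- by rewrite Lmul0r; exact: gspan0.
- by rewrite LmulDl; exact: gspanD.
- by rewrite LscaleAl; exact: gspanZ.
Qed.

Lemma gspan_vert n v z : gspan n z -> gspan n (Lmul z [v]).
Proof.
apply: gspan_mulr => v' l w m wl wm lm mn; rewrite -LmulA Lgpath_vert //.
by case: eqP => _; [exact: gspan_mono | rewrite Lmulr0; exact: gspan0].
Qed.

(** By (CK1) a nonempty [q] either loses its first edge or gives zero. If [q] is a vertex, [e] is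
    appended to [p] or gives zero, and [q] stays of length 0, as the truncated [n.-1] permits. *)
Lemma gspan_edge n e z : gspan n z -> gspan n.-1 (Lmul z (edge e)).
Proof.
apply: gspan_mulr => v l w [|f m] /= wl wm lm mn.
  have [se|se] := eqVneq (s e) w.
    rewrite -lm Lpath_end Lpath_edge ?lm // -Lpath_end pend_rcons.
    by apply: (@gspan_mono _ _ _ (r e) [::]) => //=;
      rewrite ?pend_rcons //; apply: walk_rcons; rewrite ?lm.
  rewrite -lm Lpath_end Lpath_edge0 ?lm; first exact: gspan0.
  exact/eqP.
have [fe|fe] := eqVneq f e; last first.
  by rewrite -!LmulA Lghost_edge0 ?Lmulr0; [exact: gspan0 | exact/eqP].
case: wm => [_ wm]; rewrite -!LmulA -fe Lghost_edge Lgpath_src //.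
by apply: gspan_mono => //; case: (n) mn.
Qed.

Lemma gspan_ghost n e z : gspan n z -> gspan n.+1 (Lmul z (ghost e)).
Proof.
apply: gspan_mulr => v l w m wl wm lm mn; rewrite -LmulA.
have [we|/eqP we] := eqVneq w (r e); last first.
  by rewrite Lgpath_ghost0 // Lmulr0; exact: gspan0.
by rewrite Lgpath_ghost //; apply: gspan_mono; rewrite //= -we.
Qed.

Lemma gspan_exD x y :
  (exists n, gspan n x) -> (exists n, gspan n y) -> exists n, gspan n (x + y).
Proof.
move=> [n xn] [m ym]; exists (maxn n m); apply: gspanD.
  exact: gspanW (leq_maxl _ _) xn.
exact: gspanW (leq_maxr _ _) ym.
Qed.

Lemma gspan_exM n z x : gspan n z -> exists m, gspan m (Lmul z x).
Proof.
elim/Lclass_ind: x => x.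
elim: x n z => [[v|e|e]||x IHx y IHy|a x IHx|x IHx y IHy] n z zn.
- by exists n; exact: gspan_vert.
- by exists n.-1; exact: gspan_edge.
- by exists n.+1; exact: gspan_ghost.
- by exists 0%N; rewrite -[Lclass _ _ _]/(0 : LPA s r K) Lmulr0; exact: gspan0.
- rewrite -Ladd_class LaddE LmulDr; apply: gspan_exD.
    exact: IHx zn.
  exact: IHy zn.
- rewrite -Lscale_class LscaleE LscaleAr.
  by have [m ?] := IHx _ _ zn; exists m; exact: gspanZ.
by rewrite -Lmul_class LmulA; have [m xm] := IHx _ _ zn; exact: IHy xm.
Qed.

(** Every generator absorbs a vertex on its left, so stability of the span under right
    multiplication suffices. *)
Lemma gspan_full z : exists n, gspan n z.
Proof.
have vertP v n : gspan n [v].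
  by rewrite -Lvert_idem; exact: (@gspan_mono _ v [::] v [::]).
elim/Lclass_ind: z; elim=> [[v|e|e]||x IHx y IHy|a x IHx|x IHx y IHy].
- by exists 0%N; exact: vertP.
- by rewrite -[Lclass _ _ _]/(edge e) -Ledge_src; exact: gspan_exM (vertP _ 0%N).
- by rewrite -[Lclass _ _ _]/(ghost e) -Lghost_rng; exact: gspan_exM (vertP _ 0%N).
- by exists 0%N; exact: gspan0.
- by rewrite -Ladd_class; exact: gspan_exD.
- by rewrite -Lscale_class; have [n ?] := IHx; exists n; exact: gspanZ.
by rewrite -Lmul_class; have [n xn] := IHx; exact: gspan_exM xn.
Qed.

(** The projection [P] attached to [I]; its trace is the expression in condition (P), since
    [t (e e^* ) = t (e^* e) = t (r e)]. *)
Definition gap v (I : seq E) : LPA s r K :=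
  [v] - \sum_(e <- I) Lmul (edge e) (ghost e).

(** * Projections orthogonal to finitely many edges *)

Section Gap.
Variables (v : V) (I : seq E).
Hypotheses (I_uniq : uniq I) (I_src : forall e, e \in I -> s e = v).

Lemma vert_gap : Lmul [v] (gap v I) = gap v I.
Proof.
rewrite /gap LmulBr Lvert_idem Lmul_sumr; congr (_ - _).
by apply: eq_big_seq => e /I_src <-; rewrite LmulA Ledge_src.
Qed.

Lemma ghost_gap e : e \in I -> Lmul (ghost e) (gap v I) = 0.
Proof.
move=> eI; rewrite /gap LmulBr -(I_src eI) Lghost_src Lmul_sumr.
rewrite (bigD1_seq e) //= LmulA Lghost_edge Lghost_rng big1 ?addr0 ?subrr // => f fe.
by rewrite LmulA Lghost_edge0 ?Lmul0r //; apply/eqP; rewrite eq_sym.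
Qed.

Lemma gap_idem : Lmul (gap v I) (gap v I) = gap v I.
Proof.
rewrite {1}/gap LmulBl vert_gap Lmul_suml big1_seq ?subr0 // => e /= eI.
by rewrite -LmulA ghost_gap // Lmulr0.
Qed.

Lemma Lstar_gap (kstar : K -> K) : field_involution kstar ->
  Lstar kstar (gap v I) = gap v I.
Proof.
move=> HK; rewrite /gap (LstarB HK) (Lstar_vert s r HK) (Lstar_sum HK).
congr (_ - _); apply: eq_bigr => e _.
by rewrite (LstarM HK) (Lstar_edge s r HK) (Lstar_ghost s r HK).
Qed.

End Gap.

(** * Canonical traces and definite elements *)

Section Trace.
Variables (kstar : K -> K) (R : lmodType K) (mulR : R -> R -> R) (starR : R -> R).
Hypotheses (HK : field_involution kstar) (HR : inv_algebra kstar mulR starR).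
Hypothesis (Hpd : pos_definite mulR starR).
Variable t : LPA s r K -> R.
Hypotheses (Htr : is_trace t) (Hlin : K_linear t) (Hcan : canonical_trace t).
Local Notation ge0 := (Rge0 mulR starR).
Local Notation st := (Lstar kstar).

Lemma trD x y : t (x + y) = t x + t y. Proof. exact: Htr.1. Qed.
Lemma trZ a x : t (a *: x) = a *: t x. Proof. exact: Hlin. Qed.
Lemma tr0 : t 0 = 0. Proof. by rewrite -(scale0r (0 : LPA s r K)) trZ scale0r. Qed.
Lemma trB x y : t (x - y) = t x - t y.
Proof. by rewrite trD -scaleN1r trZ scaleN1r. Qed.
Lemma tr_sum I (l : seq I) (P : pred I) (F : I -> LPA s r K) :
  t (\sum_(i <- l | P i) F i) = \sum_(i <- l | P i) t (F i).
Proof. exact: (big_morph t trD tr0). Qed.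

Lemma tr_gap v I : t (gap v I) = t [v] - \sum_(e <- I) t [r e].
Proof.
rewrite trB tr_sum; congr (_ - _); apply: eq_bigr => e _.
by rewrite Htr.2 Lghost_edge.
Qed.

Lemma tr_gapE v I :
  t (Lsub [v] (Lsum [seq [r e] | e <- I])) = t (gap v I).
Proof. by rewrite tr_gap LsubE LsumE trB tr_sum big_map. Qed.

(** Expanding the projection gives [g h^*] minus the terms [(g e) (h e)^*]. Appending the same edge
    to both paths preserves whether they are equal, so canonicity evaluates every term. *)
Lemma tr_path_gap v I (g h : V * seq E) :
    (forall e, e \in I -> s e = v) -> walk g.1 g.2 -> walk h.1 h.2 ->
    pend g.1 g.2 = v -> pend h.1 h.2 = v ->
  t (Lmul (Lmul (Lpath g.1 g.2) (gap v I)) (Lgpath h.1 h.2)) =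
  if g == h then t (gap v I) else 0.
Proof.
case: g h => [g l] [h m] /= I_src wl wm lv mv.
rewrite /gap LmulBr LmulBl -{1}lv Lpath_end -LpqE Lmul_sumr Lmul_suml trB tr_sum.
have edgeE e : e \in I ->
    Lmul (Lmul (Lpath g l) (Lmul (edge e) (ghost e))) (Lgpath h m) =
    Lpq s r K g (rcons l e) h (rcons m e).
  move=> /I_src se; rewrite LmulA Lpath_edge ?lv // -LmulA ghost_Lgpath ?mv //.
  by rewrite LpqE.
have [eq_lm neq_lm] := Hcan wl wm (etrans lv (esym mv)).
have [gh|/eqP gh] := eqVneq (g, l) (h, m).
  rewrite eq_lm // lv -[RHS]/(t (gap v I)) tr_gap; congr (_ - _).
  apply: eq_big_seq => e eI; rewrite edgeE //.
  have se := I_src e eI; case: gh => <- <-.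
  have wle : walk g (rcons l e) by apply: walk_rcons; rewrite ?lv.
  by have [-> //] := Hcan wle wle erefl; rewrite pend_rcons.
rewrite neq_lm // big1_seq ?subr0 // => e /= eI; rewrite edgeE //.
have se := I_src e eI.
have [|_ -> //] := Hcan (walk_rcons wl (etrans se (esym lv)))
  (walk_rcons wm (etrans se (esym mv))); first by rewrite !pend_rcons.
by case=> gh' /rcons_inj[lm]; apply: gh; rewrite gh' lm.
Qed.

Definition tdef (z : LPA s r K) : Prop :=
  ge0 (t (Lmul z (st z))) /\ (t (Lmul z (st z)) = 0 -> z = 0).

(** If [t (z z^* )] vanishes, so does each nonnegative summand; then all [z y] vanish, and with them
    [z], the sum of the [z y y^*]. *)
Lemma tdef_decomp z (ys : seq (LPA s r K)) :
    z = \sum_(y <- ys) Lmul (Lmul z y) (st y) ->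
  (forall y, y \in ys -> tdef (Lmul z y)) -> tdef z.
Proof.
move=> zE zyP.
have zzE : t (Lmul z (st z)) = \sum_(y <- ys) t (Lmul (Lmul z y) (st (Lmul z y))).
  rewrite {1}zE Lmul_suml tr_sum; apply: eq_bigr => y _.
  by rewrite (LstarM HK) !LmulA.
have yge0 y : y \in ys -> ge0 (t (Lmul (Lmul z y) (st (Lmul z y)))).
  by move=> /zyP[].
split; rewrite zzE; first exact: Rge0_sum.
move=> /(Rge0_sum_eq0 HR Hpd yge0) yy0; rewrite zE big1_seq // => y /= yys.
by rewrite (zyP _ yys).2 ?Lmul0r // yy0.
Qed.

(** * Faithfulness from (P) and (F) *)

Section Faithful.
Hypothesis gap_ge0 : forall v I, uniq I -> (forall e, e \in I -> s e = v) ->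
  ge0 (t (gap v I)).
Hypothesis vert_gt0 : forall v, Rgt0 mulR starR (t [v]).

Lemma tr_gap_eq0 v I : uniq I -> (forall e, e \in I -> s e = v) ->
  t (gap v I) = 0 -> gap v I = 0.
Proof.
move=> I_uniq I_src tI0.
have [I_full|/existsNP[e /not_implyP[se /negP eI]]] :=
  pselect (forall e, s e = v -> e \in I).
  (* When [I] exhausts the edges at [v], either [v] is a sink and the projection is [v], contrary to
     (F), or [v] is regular and (CK2) makes the projection zero. *)
  have [I0|I0] := eqVneq I [::].
    by case: (vert_gt0 v) => _ []; rewrite -tI0 I0 /gap big_nil subr0.
  have vI : regular_enum s v I.
    split; [exact/eqP | split; first exact/NoDup_uniq].
    by move=> e; split=> [/I_full/InP|/InP/I_src].
  by rewrite /gap (Lvert_regular r K vI) subrr.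
(* For an edge [e] at [v] outside [I], the trace of the projection is [t (r e)] plus the trace for
   [e :: I], both nonnegative; its vanishing would contradict [t (r e) > 0]. *)
case: (vert_gt0 (r e)) => re_ge0 [].
apply: (Rge0_add_eq0 HR Hpd re_ge0 (y := t (gap v (e :: I)))).
  apply: gap_ge0; first by rewrite /= eI.
  by move=> f; rewrite in_cons => /orP[/eqP ->|/I_src].
by rewrite tr_gap big_cons opprD addrCA [X in _ + X]addrA subrr add0r -tr_gap.
Qed.

Lemma tdef_path_gap v I (l : seq (K * (V * seq E))) :
    uniq I -> (forall e, e \in I -> s e = v) ->
    (forall i, i \in l -> walk i.2.1 i.2.2 /\ pend i.2.1 i.2.2 = v) ->
  tdef (Lmul (\sum_(i <- l) i.1 *: Lpath i.2.1 i.2.2) (gap v I)).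
Proof.
move=> I_uniq I_src lP; rewrite (collect_coeffs _ (fun g => Lpath g.1 g.2)).
set gs := undup _; pose c g := \sum_(i <- l | i.2 == g) i.1.
have gs_uniq : uniq gs by exact: undup_uniq.
have gsP g : g \in gs -> walk g.1 g.2 /\ pend g.1 g.2 = v.
  by rewrite mem_undup => /mapP[i /lP ? ->].
rewrite -[X in Lmul X _]/(\sum_(g <- gs) c g *: Lpath g.1 g.2).
set y := \sum_(g <- gs) _.
(* The paths in [gs] are distinct, so [tr_path_gap] leaves only the diagonal terms of the double
   sum. *)
have trE : t (Lmul (Lmul y (gap v I)) (st (Lmul y (gap v I)))) =
    \sum_(g <- gs) (c g * kstar (c g)) *: t (gap v I).
  rewrite (LstarM HK) Lstar_gap // !LmulA -[Lmul (Lmul y _) _]LmulA gap_idem //.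
  rewrite {1}/y !Lmul_suml tr_sum; apply: eq_big_seq => g ggs.
  have [wg gv] := gsP g ggs.
  rewrite !LscaleAl trZ -scalerA /y (Lstar_sum HK) Lmul_sumr tr_sum; congr (_ *: _).
  rewrite (bigD1_seq g) //= [X in _ + X]big1_seq ?addr0 => [|h /andP[hg hgs]];
    rewrite (LstarZ HK) LscaleAr trZ (Lstar_path HK) tr_path_gap //.
  - by rewrite eqxx.
  - by rewrite eq_sym (negbTE hg) scaler0.
  - by have [] := gsP h hgs.
  - by have [] := gsP h hgs.
have cge0 g : g \in gs -> ge0 ((c g * kstar (c g)) *: t (gap v I)).
  by move=> _; apply: Rge0_scale => //; exact: gap_ge0.
rewrite /tdef trE; split; first exact: Rge0_sum.
move=> /(Rge0_sum_eq0 HR Hpd cge0) c0.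
(* Either the projection itself is zero, or each [c g * kstar (c g)] is zero in the field, and then
   so is [c g]. *)
have [tI0|/eqP tI0] := pselect (t (gap v I) = 0).
  by rewrite (tr_gap_eq0 I_uniq I_src tI0) Lmulr0.
rewrite /y big1_seq ?Lmul0r // => g /= /c0/eqP; rewrite scaler_eq0 (negbTE tI0) orbF.
rewrite mulf_eq0 => /orP[/eqP->|/eqP kc0]; first by rewrite scale0r.
by rewrite -(fi_inv HK (c g)) kc0 (kstar0 HK) scale0r.
Qed.

(** The premise [0 < n] keeps the induction hypothesis from being circular at [n = 0], where [n.-1]
    is again 0; there no [q] has a first edge, so it is never called. *)
Lemma tdef_vertex v n (ms : seq mono) :
    (forall z, gspan n.-1 z -> (0 < n)%N -> tdef z) ->
    (forall i, i \in ms -> [/\ mwf i, (size i.2.2 <= n)%N & i.2.1 = v]) ->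
  tdef (\sum_(i <- ms) mval i).
Proof.
move=> IHn msP; set z := \sum_(i <- ms) _.
pose I := undup (pmap (fun i : mono => ohead i.2.2) ms).
have I_uniq : uniq I by exact: undup_uniq.
have IP e : e \in I -> exists2 i, i \in ms & exists m, i.2.2 = e :: m.
  rewrite mem_undup mem_pmap => /mapP[i ims eE]; exists i => //.
  by case: i.2.2 eE => //= f m [->]; exists m.
have I_src e : e \in I -> s e = v.
  move=> /IP[i /msP[[_ + _] _ iv] [m im]]; rewrite im iv.
  by case.
have zv : Lmul z [v] = z.
  rewrite Lmul_suml; apply: eq_big_seq => i /msP[[_ wi _] _ iv].
  by rewrite /mval LscaleAl -LmulA -iv Lgpath_src.
(* Here [z = z v] equals [z P P^*] plus the sum of the [z e e^*], because [P] is a self-adjoint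
   idempotent. *)
apply: (@tdef_decomp z (gap v I :: map edge I)).
  rewrite big_cons big_map Lstar_gap // -LmulA gap_idem // LmulBr zv Lmul_sumr.
  rewrite addrAC -addrA -sumrB big1 ?addr0 // => e _.
  by rewrite (Lstar_edge s r HK) LmulA subrr.
move=> y; rewrite in_cons => /orP[/eqP->|/mapP[e eI ->]]; last first.
  apply: IHn; last first.
    by have [i /msP[_ + _] [m im]] := IP e eI; rewrite im; case: (n).
  by apply: gspan_edge; exists ms => // i /msP[].
(* A monomial with nonempty [q] has the first edge of [q] in [I], so [P] kills it; in the others [q]
   is the vertex [v]. *)
suff -> : Lmul z (gap v I) =
    Lmul (\sum_(i <- [seq i.1 | i <- ms & nilp i.2.2]) i.1 *: Lpath i.2.1 i.2.2)
      (gap v I).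
  apply: tdef_path_gap => // _ /mapP[i + ->]; rewrite mem_filter.
  by move=> /andP[/nilP i0 /msP[[wi _ +] _ iv]]; rewrite i0 iv.
rewrite big_map big_filter [in RHS]big_mkcond !Lmul_suml; apply: eq_big_seq => i ims.
have [[wi _ pi] _ iv] := msP i ims.
rewrite /mval !LscaleAl -LmulA; case def_m: i.2.2 pi => [|e m] /= pi.
  by rewrite iv vert_gap // LscaleAl.
rewrite -LmulA ghost_gap ?Lmulr0 ?scaler0 ?Lmul0r //.
by rewrite mem_undup mem_pmap; apply/mapP; exists i; rewrite ?def_m.
Qed.

Lemma tdef_gspan n z : gspan n z -> tdef z.
Proof.
have split_src m z' : (forall z, gspan m.-1 z -> (0 < m)%N -> tdef z) ->
    gspan m z' -> tdef z'.
  move=> IHm [ms msP zE].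
  (* Right multiplication by [v] selects the monomials whose [q] starts at [v], so the finitely many
     such vertices decompose [z']. *)
  have zvE v : Lmul z' [v] = \sum_(i <- [seq i <- ms | i.2.1 == v]) mval i.
    rewrite zE Lmul_suml big_filter [in RHS]big_mkcond; apply: eq_big_seq => i.
    move=> /msP[[_ wi _] _]; rewrite /mval LscaleAl -LmulA Lgpath_vert //.
    by case: eqP => // _; rewrite Lmulr0 scaler0.
  pose vs := undup [seq i.2.1 | i <- ms].
  apply: (@tdef_decomp z' (map (fun v => [v]) vs)) => [|_ /mapP[v _ ->]].
    rewrite big_map; under eq_bigr do rewrite (Lstar_vert s r HK) -LmulA Lvert_idem zvE.
    under eq_bigr do rewrite big_filter big_mkcond.
    rewrite exchange_big zE /=; apply: eq_big_seq => i ims.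
    have ivs : i.2.1 \in vs by rewrite mem_undup; apply/mapP; exists i.
    rewrite (bigD1_seq i.2.1) ?undup_uniq //= eqxx big1 ?addr0 //.
    by move=> v; rewrite eq_sym => /negbTE ->.
  rewrite zvE; apply: (@tdef_vertex v m) => // i.
  by rewrite mem_filter => /andP[/eqP iv /msP[wfi ni]].
elim: n z => [|n IHn] z; apply: split_src => // z' ? _; exact: IHn.
Qed.

Lemma faithful_of_gap_ge0 : faithful_trace kstar mulR starR t.
Proof.
have tdefP z : tdef z by have [n /tdef_gspan] := gspan_full z.
move=> _ [[zs ->] zs_neq0]; rewrite LsumE big_map in zs_neq0 *.
have zge0 z : z \in zs -> ge0 (t (Lmul z (st z))) by case: (tdefP z).
split; rewrite tr_sum; first exact: Rge0_sum.
move=> /(Rge0_sum_eq0 HR Hpd zge0) zz0; apply: zs_neq0.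
by rewrite big1_seq // => z /= /zz0; case: (tdefP z) => _ /[apply] ->; rewrite Lmul0r.
Qed.

End Faithful.

Lemma faithful_iff_gap : faithful_trace kstar mulR starR t <->
  (forall v I, uniq I -> (forall e, e \in I -> s e = v) -> ge0 (t (gap v I))) /\
  (forall v, Rgt0 mulR starR (t [v])).
Proof.
split=> [tf|[]]; last exact: faithful_of_gap_ge0.
split=> [v I I_uniq I_src|v]; last first.
  apply: tf; split; last exact: Lvert_neq0.
  by exists [:: [v]]; rewrite LsumE big_seq1 (Lstar_vert s r HK) Lvert_idem.
(* Faithfulness speaks of nonzero elements only, so a vanishing projection is treated apart;
   otherwise [P = P P^*] is positive. *)
have [->|gap0] := eqVneq (gap v I) 0; first by rewrite tr0; exact: Rge0_0.
apply: (tf _ _).1; split; last exact/eqP.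
by exists [:: gap v I]; rewrite LsumE big_seq1 Lstar_gap // gap_idem.
Qed.

End Trace.
End Paths.

(** * The equivalence over arbitrary vertex and edge types *)

Theorem theorem3p5 (V E : Type) (s r : E -> V)
    (K : fieldType) (kstar : K -> K) (HK : field_involution kstar)
    (R : lmodType K) (mulR : R -> R -> R) (starR : R -> R)
    (HR : inv_algebra kstar mulR starR) (Hpd : pos_definite mulR starR)
    (t : LPA s r K -> R)
    (Htr : is_trace t) (Hlin : K_linear t) (Hcan : canonical_trace t) :
  faithful_trace kstar mulR starR t <->
  ((forall (v : V) (I : seq E), List.NoDup I -> (forall e, List.In e I -> s e = v) ->
      Rge0 mulR starR
        (t (Lsub (Lvert v) (Lsum (map (fun e => Lvert (r e)) I))))) /\
   (forall v : V, Rgt0 mulR starR (t (Lvert v)))).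
Proof.
(* [{classic V}] and [{classic E}] are the same types with classical decidable equality, so the
   algebra and the trace carry over unchanged. *)
have [tfP Ptf] := @faithful_iff_gap {classic V} {classic E} s r K kstar R mulR starR
  HK HR Hpd t Htr Hlin Hcan.
have gapE := @tr_gapE {classic V} {classic E} s r K R t Htr Hlin.
split=> [/tfP[gap_ge0 vert_gt0]|[gap_ge0 vert_gt0]].
  split=> // v I I_uniq I_src; rewrite gapE; apply: gap_ge0.
    exact/NoDup_uniq.
  by move=> e /InP; exact: I_src.
apply: Ptf; split=> // v I I_uniq I_src; rewrite -gapE; apply: gap_ge0.
  exact/(@NoDup_uniq {classic E}).
by move=> e /(@InP {classic E}); exact: I_src.
Qed.
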